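(* For every positive integer $n$, $$a_n\ \le\ \sum_{i=1}^{n}\left(\left\lceil\frac{2(i-1)}{3}\right\rceil+\left\lceil\frac{2(n-i)}{3}\right\rceil\right)!\cdot\left(n-\left\lceil\frac{2(i-1)}{3}\right\rceil-\left\lceil\frac{2(n-i)}{3}\right\rceil\right)!\ .$$
   Context: Places $1,\dots,n$ stand in a row; neighbouring places have distance $1$. At any time at which at least one place is occupied, the distance of an empty place $x$ is $\min|x-y|$ over all occupied places $y$. Persons arrive one after another and each occupies one empty place. Politeness rule: every person except the first (who chooses freely) occupies one of the empty places whose distance is maximal among all empty places at that time. $a_n$ is the number of sequences $(x_1,\dots,x_n)$ (permutations of $\{1,\dots,n\}$, $x_t$ being the place taken by the $t$-th person) in which $n$ persons fill all $n$ places obeying the politeness rule. *)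

(* Defs.v *)
From mathcomp Require Import all_boot all_order all_fingroup all_algebra.
From mathcomp Require Import zify.

Set Implicit Arguments.
Unset Strict Implicit.
Unset Printing Implicit Defensive.

(* Places 1, ..., n are encoded as 'I_n (place i is the ordinal i - 1, which
   preserves distances), and the t-th person is likewise the ordinal t - 1. *)

Definition place_dist (n : nat) (x y : 'I_n) : nat := maxn x y - minn x y.

(* Only meaningful for nonempty A; as all distances between places are < n,
   the neutral value n then plays no role (see dist_to_min). *)
Definition dist_to (n : nat) (A : {set 'I_n}) (x : 'I_n) : nat :=
  \big[minn/n]_(y in A) place_dist x y.

Definition occupied (n : nat) (s : {perm 'I_n}) (t : 'I_n) : {set 'I_n} :=
  [set s u | u : 'I_n & (u < t)%N].

(* That s t is itself empty when person t arrives follows from the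
   injectivity of s (see seat_empty). *)
Definition polite (n : nat) (s : {perm 'I_n}) : bool :=
  [forall t : 'I_n, (0 < t)%N ==>
    [forall x : 'I_n, (x \notin occupied s t) ==>
      (dist_to (occupied s t) x <= dist_to (occupied s t) (s t))%N]].

Definition nb_polite (n : nat) : nat := #|[set s : {perm 'I_n} | polite s]|.

(* The ceiling of m / d; see ceil_divE. *)
Definition ceil_div (m d : nat) : nat := (m + d.-1) %/ d.

Lemma dist_to_min (n : nat) (A : {set 'I_n}) (x : 'I_n) : A != set0 ->
  (exists2 y, y \in A & dist_to A x = place_dist x y) /\
  (forall y, y \in A -> dist_to A x <= place_dist x y).
Proof.
move=> /set0Pn[y0 y0A].
have lb y : y \in A -> dist_to A x <= place_dist x y.
  move=> yA; rewrite /dist_to.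
  have := mem_index_enum y; elim: (index_enum _) => // z r IH.
  rewrite inE big_cons => /orP[/eqP <-|yr]; first by rewrite yA geq_minl.
  by case: ifP => _; [rewrite geq_min IH ?orbT | exact: IH].
split=> //.
have [[y yA ->]|E] : (exists2 y, y \in A & dist_to A x = place_dist x y)
    \/ dist_to A x = n.
- rewrite /dist_to; elim/big_rec: _ => [|y m yA IH]; first by right.
  rewrite /minn; case: ifP => _; last by [].
  by left; exists y.
- by exists y.
- have := lb _ y0A; rewrite E /place_dist.
  by have := ltn_ord x; have := ltn_ord y0; lia.
Qed.

Lemma seat_empty (n : nat) (s : {perm 'I_n}) (t : 'I_n) :
  s t \notin occupied s t.
Proof.
apply/imsetP => -[u]; rewrite inE => ut /perm_inj tu.
by rewrite tu ltnn in ut.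
Qed.

Lemma ceil_divE (m d : nat) : 0 < d ->
  Num.ceil (m%:R / d%:R : rat)%R = Posz (ceil_div m d).
Proof.
move=> d0; apply: Num.Theory.ceil_def.
have d0' : (0 < d%:R :> rat)%R by rewrite Num.Theory.ltr0n.
rewrite Num.Theory.ltr_pdivlMr // Num.Theory.ler_pdivrMr //.
have -> : (d%:R = (Posz d)%:~R :> rat)%R by [].
have -> : (m%:R = (Posz m)%:~R :> rat)%R by [].
rewrite -!intrM ltr_int ler_int /ceil_div.
have := divn_eq (m + d.-1) d; have := ltn_pmod (m + d.-1) d0.
move: (_ %/ _) (_ %% _) => q r; nia.
Qed.

(* The subtraction in the bound is never truncated. *)
Lemma bound_subn_ok (n i : nat) : 0 < i <= n ->
  ceil_div (2 * (i - 1)) 3 + ceil_div (2 * (n - i)) 3 <= n.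
Proof. by rewrite /ceil_div; lia. Qed.

(* Main.v *)
Require Import Defs.
From mathcomp Require Import all_boot all_fingroup.
From mathcomp Require Import zify.

Set Implicit Arguments.
Unset Strict Implicit.
Unset Printing Implicit Defensive.

(** In an inner gap of [L] places every person seated at distance at least 2
takes a middle place, so the numbers [S] of persons eventually seated at
distance at least 2 and [k] of those seated at distance 1 are determined by the
gaps. The last [k] persons have [k!] orders. When the maximal distance is at
least 2, the number of choices may exceed the number of persons still to be
seated at such a distance, because an even gap has two middle places; giving
the gaps on which this matters a weight 2, the number of polite continuations
is at most [k! S! W], with [W] the product of the weights. After the first
person [W = 1], [k + S = n - 1] and both [k] and [S] are at most the sum [c] of
the two ceilings, hence [k! S! <= c! (n - c)!]. *)

(** * Far seats in a single gap *)

Fixpoint far_seats_rec (k L : nat) : nat :=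
  if k is k'.+1 then
    if L <= 2 then 0
    else (far_seats_rec k' (L.-1)./2 + far_seats_rec k' L./2).+1
  else 0.

(** The first argument of [far_seats_rec] is fuel, as halving is not structural; [L] rounds
    suffice. *)
Definition far_seats (L : nat) : nat := far_seats_rec L L.

Lemma far_seats_recE (k L : nat) : L <= k -> far_seats_rec k L = far_seats L.
Proof.
rewrite /far_seats; have [m] := ubnP L; elim: m k L => // m IH k L Lm Lk.
case: k Lk => [|k] Lk; first by have -> : L = 0 by lia.
case: L Lm Lk => [|L] Lm Lk //=; case: ifP => // L2.
by rewrite !(IH k) ?(IH L) //; lia.
Qed.

Lemma far_seatsE (L : nat) : far_seats L =
  if L <= 2 then 0 else (far_seats (L.-1)./2 + far_seats L./2).+1.
Proof.
case: L => [|L] //; rewrite {1}/far_seats /=.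
by case: ifP => // L2; rewrite !far_seats_recE //; lia.
Qed.

(** The halves have total length [L - 1]; the loss of 2 in each is made up exactly by the 3 that the
    middle person contributes. *)
Lemma far_seats_lower (L : nat) : L <= 3 * far_seats L + 2.
Proof.
have [m] := ubnP L; elim: m L => // m IH L Lm; rewrite far_seatsE.
case: ifP => L2; first by lia.
have := IH (L.-1)./2; have := IH L./2; lia.
Qed.

Lemma far_seats_upper (L : nat) : 0 < L -> 2 * far_seats L < L.
Proof.
have [m] := ubnP L; elim: m L => // m IH L Lm L0; rewrite far_seatsE.
case: ifP => L2; first by lia.
have := IH (L.-1)./2; have := IH L./2; lia.
Qed.

(* In an end gap the first person takes the extreme place, which turns the
   gap into an inner one. *)
Definition end_far_seats (m : nat) : nat :=
  if m <= 1 then 0 else (far_seats m.-1).+1.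

(* Length 4 needs weight 2 since its two middle places serve a single far
   person; the weight of the lengths >= 8 then absorbs that of their halves. *)
Definition weight (L : nat) : nat := ((L == 4) || (8 <= L)).+1.

Lemma weight_split (L : nat) : 2 < L ->
  (~~ odd L).+1 * (weight (L.-1)./2 * weight L./2) <= far_seats L * weight L.
Proof.
(* From length 12 on there are at least 4 far seats and the weight is 2, so the right side reaches 8
   = 2 * 2 * 2; shorter lengths are computed one by one. *)
move=> L2; case: (leqP 12 L) => L12; last first.
  by move: L L2 L12; do 12 (case=> //).
have := far_seats_lower L; rewrite /weight => lo.
have -> : (8 <= L) by lia.
rewrite orbT; have le2 (c : bool) : c.+1 <= 2 by case: c.
apply: (@leq_trans (2 * (2 * 2))); first by do !apply: leq_mul.
by lia.
Qed.

(** An end gap offers only one farthest place, so weight 1 is enough for it: its far seats pay for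
    the inner gap that arises. *)
Lemma weight_end (m : nat) : 1 < m -> weight m.-1 <= end_far_seats m.
Proof.
move=> m1; rewrite /end_far_seats; have -> : (m <= 1) = false by lia.
have := far_seats_lower m.-1; rewrite /weight.
by move: (far_seats _) => e; case: eqP; case: leqP => /=; lia.
Qed.

(* In [gap_*] and [row_*] the places are [1, ..., n], with [0] and [n.+1] as
   virtual ends of the row; [row_* n a t] describes the part of the row from
   the occupied place (or end) [a] on, [t] being the increasing list of the
   occupied places beyond [a], closed by [n.+1]. *)
Definition gap_dist (n a b x : nat) : nat :=
  if a == 0 then b - x else if b == n.+1 then x - a else minn (x - a) (b - x).

Definition gap_far (n a b : nat) : nat :=
  if (a == 0) || (b == n.+1) then end_far_seats (b - a).-1
  else far_seats (b - a).-1.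

Definition gap_weight (n a b : nat) : nat :=
  if (a == 0) || (b == n.+1) then 1 else weight (b - a).-1.

(** * Farthest places of one gap *)

Definition farthest_in_gap (n a b x : nat) : Prop :=
  [/\ a < x < b, 2 <= gap_dist n a b x &
      forall y, a < y < b -> gap_dist n a b y <= gap_dist n a b x].

Lemma farthest_in_gapP (n a b x : nat) :
  a < b <= n.+1 -> (0 < a) || (b <= n) -> farthest_in_gap n a b x ->
  [\/ [/\ a = 0, x = 1, b <= n & 2 < b],
      [/\ 0 < a, b = n.+1, x = n & a.+2 < b] |
      [/\ 0 < a, b <= n, a.+3 < b &
        x = a + (b - a)./2 \/ x = a + (b - a).+1./2 ]].
Proof.
move=> /andP[ab bn1] ok [/andP[ax xb]]; rewrite /gap_dist.
(* Each kind of gap has one competitor that pins [x] down: the extreme place at an end, the middle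
   place in an inner gap. *)
case: eqP => a0; first by move=> d2 /(_ a.+1) dmax; constructor 1; split; lia.
case: eqP => bn; first by move=> d2 /(_ b.-1) dmax; constructor 2; split; lia.
rewrite leq_min => /andP[d2a d2b] /(_ (a + (b - a)./2)).
have -> : minn (a + (b - a)./2 - a) (b - (a + (b - a)./2)) = (b - a)./2 by lia.
have mid : a < a + (b - a)./2 < b by lia.
by rewrite leq_min => /(_ mid)/andP[da db]; constructor 3; split; lia.
Qed.

(** Either middle place of an even gap leaves the same two lengths up to order, so the count does
    not depend on the choice. *)
Lemma gap_far_split (n a b x : nat) :
  a < b <= n.+1 -> (0 < a) || (b <= n) -> farthest_in_gap n a b x ->
  (gap_far n a x + gap_far n x b).+1 = gap_far n a b.
Proof.
move=> ab ok fx; rewrite /gap_far.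
case: (farthest_in_gapP ab ok fx) =>
  [[-> -> bn b2]|[a0 -> -> an]|[a0 bn ab3 xE]].
- rewrite eqxx /= {1}/end_far_seats /=.
  have -> : (b == n.+1) = false by lia.
  rewrite /end_far_seats; have -> : ((b - 0).-1 <= 1) = false by lia.
  by rewrite add0n; congr (_.+1); congr far_seats; lia.
- rewrite eqxx orbT /=.
  have -> : (a == 0) || (n == n.+1) = false by lia.
  rewrite orbT /end_far_seats.
  have -> : ((n.+1 - n).-1 <= 1) by lia.
  have -> : ((n.+1 - a).-1 <= 1) = false by lia.
  by rewrite addn0; congr (_.+1); congr far_seats; lia.
- have -> : (a == 0) || (x == n.+1) = false by lia.
  have -> : (x == 0) || (b == n.+1) = false by lia.
  have -> : (a == 0) || (b == n.+1) = false by lia.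
  rewrite [RHS]far_seatsE; have -> : ((b - a).-1 <= 2) = false by lia.
  congr (_.+1); case: xE => xE.
    by congr (far_seats _ + far_seats _); lia.
  by rewrite addnC; congr (far_seats _ + far_seats _); lia.
Qed.

Lemma card_ord_le_size (n : nat) (Q : pred 'I_n) (s : seq nat) :
  (forall x, Q x -> x.+1 \in s) -> #|Q| <= size s.
Proof.
move=> Qs; rewrite cardE -(size_map (fun x : 'I_n => x.+1)).
apply: uniq_leq_size.
  rewrite map_inj_uniq ?enum_uniq //.
  by move=> x y [] /val_inj.
by move=> _ /mapP[x + ->]; rewrite mem_enum; apply: Qs.
Qed.

Lemma sum_ord_le_size (n : nat) (Q : pred 'I_n) (f : 'I_n -> nat) (c : nat)
    (s : seq nat) :
  (forall x, Q x -> x.+1 \in s) -> (forall x, Q x -> f x <= c) ->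
  \sum_(x | Q x) f x <= size s * c.
Proof.
move=> Qs fc; apply: (@leq_trans (\sum_(x | Q x) c)); first exact: leq_sum.
by rewrite sum_nat_const leq_mul2r card_ord_le_size ?orbT.
Qed.

(** [Q] may miss some farthest places of the gap, or all of them when those of the whole row lie
    elsewhere. *)
Lemma gap_weight_split (n a b : nat) (Q : pred 'I_n) :
  a < b <= n.+1 -> (0 < a) || (b <= n) ->
  (forall x : 'I_n, Q x -> farthest_in_gap n a b x.+1) ->
  \sum_(x | Q x) gap_weight n a x.+1 * gap_weight n x.+1 b
    <= gap_far n a b * gap_weight n a b.
Proof.
move=> ab ok Qf; have Qc x (Qx : Q x) := farthest_in_gapP ab ok (Qf x Qx).
have [/existsP[x0 Qx0]|/existsPn Q0] := boolP [exists x, Q x]; last first.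
  by rewrite big1 // => x Qx; have := Q0 x; rewrite Qx.
case: (Qc x0 Qx0) => [[a0 _ bn b2]|[a0 bn _ an]|[a0 bn ab3 _]].
- rewrite -(mul1n (_ * _)); apply: (@sum_ord_le_size _ _ _ _ [:: 1]) => x Qx.
    by case: (Qc x Qx) => [[]|[]|[]]; rewrite ?inE; lia.
  case: (Qc x Qx) => [[_ -> _ _]|[]|[]]; try lia.
  rewrite /gap_weight /gap_far a0 eqxx /=.
  have -> : (b == n.+1) = false by lia.
  have := @weight_end b.-1; rewrite subn0 subn1; lia.
- rewrite -(mul1n (_ * _)); apply: (@sum_ord_le_size _ _ _ _ [:: n]) => x Qx.
    by case: (Qc x Qx) => [[]|[]|[]]; rewrite ?inE; lia.
  case: (Qc x Qx) => [[]|[_ _ -> _]|[]]; try lia.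
  rewrite /gap_weight /gap_far bn eqxx !orbT /=.
  have -> : (a == 0) || (n == n.+1) = false by lia.
  have := @weight_end (n - a).
  have -> : (n.+1 - a).-1 = n - a by lia.
  lia.
- have -> : gap_weight n a b = weight (b - a).-1.
    by rewrite /gap_weight; case: ifP => //; lia.
  have -> : gap_far n a b = far_seats (b - a).-1.
    by rewrite /gap_far; case: ifP => //; lia.
  set L := (b - a).-1; apply: leq_trans (@weight_split L _); last by lia.
  (* [undup] merges the two middle places when [L] is odd. *)
  have -> : (~~ odd L).+1 = size (undup [:: a + (b - a)./2; a + (b - a).+1./2]).
    by rewrite /= inE; case: ifP => /=; lia.
  apply: sum_ord_le_size => x Qx.
    rewrite mem_undup !inE.
    by case: (Qc x Qx) => [[]|[]|[]]; lia.
  case: (Qc x Qx) => [[]|[]|[_ _ _ xE]]; try lia.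
  rewrite /gap_weight.
  have -> : (a == 0) || (x.+1 == n.+1) = false by lia.
  have -> : (x.+1 == 0) || (b == n.+1) = false by lia.
  case: xE => ->.
    by apply/eq_leq; congr (weight _ * weight _); lia.
  by rewrite mulnC; apply/eq_leq; congr (weight _ * weight _); lia.
Qed.

(** * The row as a sequence of gaps *)

Fixpoint insert (x : nat) (t : seq nat) : seq nat :=
  if t is b :: t' then if x < b then x :: t else b :: insert x t' else [:: x].

Fixpoint row_dist (n a : nat) (t : seq nat) (x : nat) : nat :=
  if t is b :: t' then
    if x < b then gap_dist n a b x else row_dist n b t' x
  else 0.

Fixpoint row_far (n a : nat) (t : seq nat) : nat :=
  if t is b :: t' then gap_far n a b + row_far n b t' else 0.

Fixpoint row_weight (n a : nat) (t : seq nat) : nat :=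
  if t is b :: t' then gap_weight n a b * row_weight n b t' else 1.

(** The last clause rules out a gap between the two virtual ends. *)
Definition row (n a : nat) (t : seq nat) : bool :=
  [&& path ltn a t, last a t == n.+1 & (0 < a) || (head n.+1 t <= n)].

Lemma row_cons (n a b : nat) (t : seq nat) : row n a (b :: t) ->
  [/\ a < b <= n.+1, (0 < a) || (b <= n) &
      if t is [::] then b = n.+1 else b <= n /\ row n b t].
Proof.
rewrite /row /= => /and3P[/andP[ab pt] /eqP lt ok].
have bn c r : path ltn c r -> c <= last c r.
  by elim: r c => //= d r IH c /andP[cd /IH]; lia.
split=> //; first by have := bn _ _ pt; lia.
case: t pt lt => //= c t /andP[bc pt] lt.
have := bn _ _ pt; rewrite lt eqxx bc pt => cn; split; lia.
Qed.

Lemma mem_insert (x y : nat) (t : seq nat) :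
  (y \in insert x t) = (y == x) || (y \in t).
Proof.
elim: t => //= b t IH; case: ifP => _; rewrite !inE // IH.
by rewrite orbCA.
Qed.

Definition farthest_in_row (n a : nat) (t : seq nat) (x : nat) : Prop :=
  [/\ a < x <= n, x \notin t, 2 <= row_dist n a t x &
      forall y, a < y <= n -> y \notin t ->
        row_dist n a t y <= row_dist n a t x].

Lemma row_gt (a y : nat) (t : seq nat) : path ltn a t -> y \in t -> a < y.
Proof.
elim: t a => //= b t IH a /andP[ab pt]; rewrite inE => /predU1P[->//|yt].
by have := IH _ pt yt; lia.
Qed.

Lemma farthest_in_row_head (n a b x : nat) (t : seq nat) :
  row n a (b :: t) -> x < b -> farthest_in_row n a (b :: t) x ->
  farthest_in_gap n a b x.
Proof.
move=> rw xb; have /and3P[/= /andP[ab pt] _ _] := rw.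
have [abn ok _] := row_cons rw.
rewrite /farthest_in_row /= xb => -[xa xt d2 dmax]; split=> //; first by lia.
move=> y yab; have := dmax y; have -> : y < b by lia.
apply; first by lia.
rewrite inE negb_or; apply/andP; split; first by lia.
by apply/negP => /(row_gt pt); lia.
Qed.

Lemma farthest_in_row_tail (n a b x : nat) (t : seq nat) :
  a < b -> b < x -> farthest_in_row n a (b :: t) x -> farthest_in_row n b t x.
Proof.
move=> ab bx; rewrite /farthest_in_row /=; have -> : (x < b) = false by lia.
rewrite inE negb_or => -[xa /andP[_ xt] d2 dmax]; split=> //; first by lia.
move=> y yb yt; have := dmax y; have -> : (y < b) = false by lia.
by apply; [lia|rewrite inE negb_or yt andbT; lia].
Qed.

Lemma row_insert (n a x : nat) (t : seq nat) :
  row n a t -> a < x <= n -> x \notin t -> row n a (insert x t).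
Proof.
rewrite /row => /and3P[pt lt ok] xa xt.
have hd : (0 < a) || (head n.+1 (insert x t) <= n).
  by case: t {pt lt xt} ok => [|b t] /=; [|case: ifP => /=]; lia.
rewrite hd andbT {ok hd}; elim: t a pt lt xt xa => [|b t IH] a /=.
  by move=> _; lia.
move=> /andP[ab pt] lt; rewrite inE negb_or => /andP[xb xt] xa.
case: ifP => xb' /=; first by rewrite xb' pt lt; lia.
by rewrite ab /= IH //; lia.
Qed.

(** Only the gap containing [x] changes. Hence all polite continuations seat equally many persons at
    distance at least 2. *)
Lemma row_far_insert (n a x : nat) (t : seq nat) :
  row n a t -> farthest_in_row n a t x ->
  (row_far n a (insert x t)).+1 = row_far n a t.
Proof.
elim: t a => [|b t IH] a rw fx; first by case: fx => _ _; rewrite /= ltn0.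
have [abn ok nxt] := row_cons rw; have [xa xt _ _] := fx.
rewrite /=; case: ifP => xb /=.
  have <- := gap_far_split abn ok (farthest_in_row_head rw xb fx); lia.
have bx : b < x by move: xt; rewrite inE; lia.
have fx' : farthest_in_row n b t x by apply: farthest_in_row_tail bx fx; lia.
case: t nxt rw fx xt fx' IH => [|c t] nxt rw fx xt fx' IH; first by lia.
by rewrite -addnS IH //; case: nxt.
Qed.

(** As in a product rule, a choice alters the factors of one gap only; summing the gap inequalities
    over all gaps yields [row_far]. *)
Lemma row_weight_insert (n a : nat) (t : seq nat) (Q : pred 'I_n) :
  row n a t -> (forall x : 'I_n, Q x -> farthest_in_row n a t x.+1) ->
  \sum_(x | Q x) row_weight n a (insert x.+1 t)
    <= row_far n a t * row_weight n a t.
Proof.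
elim: t a Q => [|b t IH] a Q rw Qf.
  by rewrite big1 // => x /Qf[_ _]; rewrite ltn0.
have [abn ok nxt] := row_cons rw.
rewrite (bigID (fun x : 'I_n => x.+1 < b)) /= mulnDl; apply: leq_add.
  rewrite mulnA.
  rewrite (eq_bigr (fun x : 'I_n => gap_weight n a x.+1 *
    gap_weight n x.+1 b * row_weight n b t)); last first.
    by move=> x /andP[_ xb]; rewrite xb /= mulnA.
  rewrite -big_distrl leq_mul2r; apply/orP; right.
  apply: gap_weight_split => // x /andP[Qx xb].
  exact: farthest_in_row_head (Qf x Qx).
rewrite (eq_bigr (fun x : 'I_n => gap_weight n a b *
  row_weight n b (insert x.+1 t))); last first.
  by move=> x /andP[_ /negbTE->].
rewrite -big_distrr mulnCA leq_mul2l; apply/orP; right.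
have Qb (x : 'I_n) : Q x -> ~~ (x.+1 < b) -> b < x.+1.
  by move=> /Qf[_ + _ _]; rewrite inE; lia.
case: t nxt rw Qf IH => [|c t] nxt rw Qf IH.
  by rewrite big1 // => x /andP[Qx /(Qb _ Qx)]; have := ltn_ord x; lia.
apply: IH => [|x /andP[Qx xb]]; first by case: nxt.
by apply: farthest_in_row_tail (Qb _ Qx xb) (Qf _ Qx); lia.
Qed.

Lemma row_far_eq0 (n a : nat) (t : seq nat) : row n a t ->
  (forall y, a < y <= n -> y \notin t -> row_dist n a t y <= 1) ->
  row_far n a t = 0.
Proof.
elim: t a => //= b t IH a rw d1.
have [abn ok nxt] := row_cons rw; have /and3P[/= /andP[ab pt] _ _] := rw.
have dgap y : a < y < b -> gap_dist n a b y <= 1.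
  move=> yab; have := d1 y; have -> : y < b by lia.
  apply; first by lia.
  rewrite inE negb_or; apply/andP; split; first by lia.
  by apply/negP => /(row_gt pt); lia.
have -> : gap_far n a b = 0.
  (* As soon as the gap has a far seat, its test place ([a.+1], [b.-1] or [a.+2]) is at distance at
     least 2. *)
  move: dgap; rewrite /gap_dist /gap_far /end_far_seats.
  case: eqP => a0 /=; first by move=> /(_ a.+1) d; case: ifP; lia.
  case: eqP => bn /=; first by move=> /(_ b.-1) d; case: ifP; lia.
  by move=> /(_ a.+2) d; rewrite far_seatsE; case: ifP => //; lia.
case: t nxt rw d1 pt IH => [|c t] //= [bn rw'] rw d1 pt IH.
rewrite IH // => y yb yt; have := d1 y.
have -> : (y < b) = false by lia.
by apply; [lia|rewrite inE negb_or yt andbT; lia].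
Qed.

(** Occupied places beyond the current gap are farther away than its nearer real end; [0 < y <= n]
    discards the virtual ends. *)
Lemma row_dist_min (n a x : nat) (t : seq nat) :
  row n a t -> a < x <= n -> x \notin t ->
  (exists y, [/\ y \in a :: t, 0 < y <= n &
     row_dist n a t x = maxn x y - minn x y]) /\
  (forall y, y \in a :: t -> 0 < y <= n ->
     row_dist n a t x <= maxn x y - minn x y).
Proof.
elim: t a => [|b t IH] a rw xa xt; first by move: rw; rewrite /row /=; lia.
have [abn ok nxt] := row_cons rw; have /and3P[/= /andP[ab pt] _ _] := rw.
move: xt; rewrite inE negb_or => /andP[xb xt].
case: ifP => xltb.
  split; last first.
    move=> y; rewrite !inE /gap_dist => /or3P[/eqP->|/eqP->|/(row_gt pt) yb];
    by case: ifP; [|case: ifP]; lia.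
  rewrite /gap_dist; case: eqP => a0.
    by exists b; rewrite !inE eqxx orbT; split; lia.
  case: eqP => bn; first by exists a; rewrite !inE eqxx; split; lia.
  case: (leqP (x - a) (b - x)) => c.
    by exists a; rewrite !inE eqxx; split; lia.
  by exists b; rewrite !inE eqxx orbT; split; lia.
case: t nxt rw xt pt IH => [|c t] nxt rw xt pt IH; first by lia.
have bx : b < x <= n by lia.
have [[y [yt yn dy]] lb] := IH b nxt.2 bx xt; split.
  by exists y; split=> //; rewrite inE yt orbT.
move=> z; rewrite inE => /predU1P[-> _|]; last exact: lb.
by have := lb b; rewrite inE eqxx; lia.
Qed.

(** * Rows and sets of occupied places (ordinals count from 0, rows from 1) *)

Definition rowset (n : nat) (A : {set 'I_n}) (t : seq nat) : Prop :=
  row n 0 t /\ forall x : 'I_n, (x.+1 \in t) = (x \in A).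

Lemma dist_to_row (n : nat) (A : {set 'I_n}) (t : seq nat) (x : 'I_n) :
  rowset A t -> x \notin A -> dist_to A x = row_dist n 0 t x.+1.
Proof.
move=> [rw mt] xA.
have x0 : 0 < x.+1 <= n by have := ltn_ord x; lia.
have xt : x.+1 \notin t by rewrite mt.
have [[y [yt yn dy]] lb] := row_dist_min rw x0 xt.
have y1n : y.-1 < n by lia.
have zA : Ordinal y1n \in A.
  move: yt; rewrite -mt inE /= prednK; last by lia.
  by case/predU1P => // y0; lia.
have A0 : A != set0 by apply/set0Pn; exists (Ordinal y1n).
have [[u uA dE] le_d] := dist_to_min x A0.
apply/eqP; rewrite eqn_leq {2}dE dy; apply/andP; split.
  by have := le_d _ zA; rewrite /place_dist /=; lia.
rewrite -dy; apply: leq_trans (lb u.+1 _ _) _.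
- by rewrite inE mt uA orbT.
- by have := ltn_ord u; lia.
- by rewrite /place_dist; lia.
Qed.

Lemma rowset_insert (n : nat) (A : {set 'I_n}) (t : seq nat) (x : 'I_n) :
  rowset A t -> x \notin A -> rowset (x |: A) (insert x.+1 t).
Proof.
move=> [rw mt] xA; split.
  by apply: row_insert => //; rewrite ?mt //; have := ltn_ord x; lia.
by move=> y; rewrite mem_insert mt !inE eqSS.
Qed.

(** * Counting polite continuations *)

Definition polite_choice (n : nat) (A : {set 'I_n}) (x : 'I_n) : bool :=
  (x \notin A) && [forall y, (y \notin A) ==> (dist_to A y <= dist_to A x)].

Fixpoint completions (n m : nat) (A : {set 'I_n}) : seq (seq 'I_n) :=
  if m is m'.+1 then
    flatten [seq map (cons x) (completions m' (x |: A))
            | x <- enum (polite_choice A)]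
  else [:: [::]].

Lemma size_completionsS (n m : nat) (A : {set 'I_n}) :
  size (completions m.+1 A)
    = \sum_(x | polite_choice A x) size (completions m (x |: A)).
Proof.
rewrite /= size_flatten /shape -map_comp sumnE big_map big_enum /=.
by apply: eq_bigr => x _; rewrite size_map.
Qed.

Lemma card_setC_add (n m : nat) (A : {set 'I_n}) (x : 'I_n) :
  #|~: A| = m.+1 -> x \notin A -> #|~: (x |: A)| = m.
Proof.
move=> cA xA; move: cA; rewrite (cardsD1 x (~: A)) in_setC xA => -[<-].
by apply: eq_card => y; rewrite !inE negb_or.
Qed.

Lemma size_completions_fact (n m : nat) (A : {set 'I_n}) :
  #|~: A| = m -> size (completions m A) <= m`!.
Proof.
elim: m A => // m IH A cA; rewrite size_completionsS factS.
apply: (@leq_trans (\sum_(x | polite_choice A x) m`!)).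
  by apply: leq_sum => x /andP[xA _]; apply/IH/card_setC_add.
rewrite sum_nat_const leq_mul2r -cA; apply/orP; right.
by apply/subset_leq_card/subsetP => x; rewrite inE => /andP[].
Qed.

Lemma row_weight_gt0 (n a : nat) (t : seq nat) : 0 < row_weight n a t.
Proof.
elim: t a => //= b t IH a; rewrite muln_gt0 IH andbT.
by rewrite /gap_weight; case: ifP.
Qed.

Lemma polite_choice_farthest (n : nat) (A : {set 'I_n}) (t : seq nat)
    (x0 x : 'I_n) :
  rowset A t -> x0 \notin A -> 2 <= dist_to A x0 -> polite_choice A x ->
  farthest_in_row n 0 t x.+1.
Proof.
move=> rA x0A d2 /andP[xA /forallP dmax]; have [rw mt] := rA; split.
- by have := ltn_ord x; lia.
- by rewrite mt.
- rewrite -(dist_to_row rA xA); apply: leq_trans d2 _.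
  by have := dmax x0; rewrite x0A.
- move=> y yn yt; have y1n : y.-1 < n by lia.
  have yE : y = (Ordinal y1n).+1 by rewrite /=; lia.
  rewrite yE mt in yt; rewrite yE -(dist_to_row rA xA) -(dist_to_row rA yt).
  by have := dmax (Ordinal y1n); rewrite yt.
Qed.

Lemma size_completions (n m : nat) (A : {set 'I_n}) (t : seq nat) :
  rowset A t -> #|~: A| = m ->
  size (completions m A)
    <= (m - row_far n 0 t)`! * (row_far n 0 t)`! * row_weight n 0 t.
Proof.
elim: m A t => [|m IH] A t rA cA.
  by rewrite /= !muln_gt0 !fact_gt0 row_weight_gt0.
have [/existsP[x0 /andP[x0A d2]]|/existsPn d1] :=
    boolP [exists x, (x \notin A) && (2 <= dist_to A x)]; last first.
  have -> : row_far n 0 t = 0.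
    apply: (row_far_eq0 rA.1) => y yn yt; have y1n : y.-1 < n by lia.
    have yE : y = (Ordinal y1n).+1 by rewrite /=; lia.
    rewrite yE rA.2 in yt; rewrite yE -(dist_to_row rA yt).
    by have := d1 (Ordinal y1n); rewrite yt -leqNgt.
  rewrite subn0 fact0 muln1; apply: leq_trans (size_completions_fact cA) _.
  by rewrite leq_pmulr ?row_weight_gt0.
have far x := polite_choice_farthest rA x0A d2 (x := x).
rewrite size_completionsS; set f := row_far n 0 t.
apply: (@leq_trans (\sum_(x | polite_choice A x)
    (m.+1 - f)`! * (f.-1)`! * row_weight n 0 (insert x.+1 t))).
  apply: leq_sum => x cx; have xA : x \notin A by case/andP: cx.
  apply: leq_trans (IH _ _ (rowset_insert rA xA) (card_setC_add cA xA)) _.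
  (* Persons left and far seats both drop by one, so the number of persons at distance 1 is
     unchanged. *)
  by rewrite /f -(row_far_insert rA.1 (far x cx)) subSS.
rewrite -big_distrr /=.
have := row_weight_insert rA.1 far; rewrite -/f.
(* For [f = 0] the sum vanishes; otherwise the factor [f] from [row_weight_insert] completes the
   factorial of [f.-1] to that of [f]. *)
case: f => [|f] le_sum.
  by move: le_sum; rewrite mul0n leqn0 => /eqP->; rewrite muln0.
rewrite factS /=; apply: leq_trans (leq_mul (leqnn _) le_sum) _.
by apply/eq_leq; lia.
Qed.

(** * Factorial estimate and the choice of the first person *)

Lemma leq_fact_mul (k s c : nat) : k <= c <= (k + s).+1 -> s <= c ->
  k`! * s`! <= c`! * ((k + s).+1 - c)`!.
Proof.
move=> /andP[kc]; elim: c kc => [|c IH] kc cn sc.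
  have -> : k = 0 by lia.
  by have -> : s = 0 by lia.
(* The induction starts at the larger of [k] and [s], where the other factorial only gains a
   factor. *)
case: (ltnP c k) => ck.
  have <- : k = c.+1 by lia.
  have -> : (k + s).+1 - k = s.+1 by lia.
  by rewrite factS leq_mul2l leq_pmull ?orbT.
case: (ltnP c s) => cs.
  have <- : s = c.+1 by lia.
  have -> : (k + s).+1 - s = k.+1 by lia.
  by rewrite mulnC factS leq_mul2l leq_pmull ?orbT.
(* Raising [c] by one multiplies the right side by [(c + 1) / (k + s + 1 - c)], at least 1 as [c] is
   at least [k] and [s]. *)
apply: leq_trans (IH ck _ cs) _; first by lia.
have -> : (k + s).+1 - c = ((k + s).+1 - c.+1).+1 by lia.
rewrite !factS; set d := _ - c.+1.
rewrite mulnCA mulnA leq_mul2r leq_mul2r; apply/orP; right.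
by apply/orP; right; lia.
Qed.

(** Added over both end gaps, the left inequality gives [s <= c] and the right one [k <= c]. *)
Lemma end_far_seats_bounds (m : nat) :
  2 * end_far_seats m <= m <= end_far_seats m + ceil_div (2 * m) 3.
Proof.
rewrite /end_far_seats /ceil_div; case: ifP => m1; first by lia.
have := far_seats_lower m.-1; have := @far_seats_upper m.-1; lia.
Qed.

Lemma size_completions1 (n : nat) (i : 'I_n) (c : nat) :
  c = ceil_div (2 * i) 3 + ceil_div (2 * (n - i.+1)) 3 ->
  size (completions n.-1 [set i]) <= c`! * (n - c)`!.
Proof.
move=> cE; have in' := ltn_ord i.
have rA : rowset [set i] [:: i.+1; n.+1].
  split; first by rewrite /row /= eqxx; lia.
  by move=> x; rewrite !inE !eqSS -val_eqE /=; have := ltn_ord x; lia.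
have cA : #|~: [set i]| = n.-1.
  by have := cardsC [set i]; rewrite cards1 card_ord; lia.
apply: leq_trans (size_completions rA cA) _.
have -> : row_weight n 0 [:: i.+1; n.+1] = 1.
  by rewrite /= /gap_weight !eqxx.
have -> : row_far n 0 [:: i.+1; n.+1]
    = end_far_seats i + end_far_seats (n - i.+1).
  rewrite /= /gap_far !eqxx /= addn0.
  by congr (_ + end_far_seats _); lia.
have /andP[l1 u1] := end_far_seats_bounds i.
have /andP[l2 u2] := end_far_seats_bounds (n - i.+1).
rewrite muln1; set s := end_far_seats _ + _; set k := n.-1 - s.
have -> : n - c = (k + s).+1 - c by lia.
by apply: leq_fact_mul; rewrite /ceil_div in cE u1 u2; lia.
Qed.

(** * From permutations to seating lists *)

Lemma polite_completion (n m j : nat) (s : {perm 'I_n}) :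
  polite s -> m + j = n ->
  drop j (codom s) \in completions m [set s u | u : 'I_n & u < j].
Proof.
move=> ps; elim: m j => [|m IH] j mj.
  by rewrite drop_oversize ?inE // size_codom card_ord; lia.
have jn : j < n by lia.
pose x := Ordinal jn; apply/flatten_mapP; exists (s x).
  rewrite mem_enum; apply/andP; split; first exact: seat_empty s x.
  (* The first person is covered too: all distances to set0 are the default n. *)
  have [j0|j0] := posnP j; last first.
    by have /forallP/(_ x)/implyP := ps; apply.
  apply/forallP => y; apply/implyP => _; rewrite /dist_to !big_pred0 // => z;
    by apply/imsetP => -[u]; rewrite inE j0.
have -> : drop j (codom s) = s x :: drop j.+1 (codom s).
  rewrite (drop_nth (s x)) ?size_codom ?card_ord //; congr (_ :: _).
  rewrite /codom /image_mem (nth_map x) ?size_enum_ord //.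
  by congr (s _); apply: val_inj; rewrite /= nth_enum_ord.
have -> : s x |: [set s u | u : 'I_n & u < j] = [set s u | u : 'I_n & u < j.+1].
  apply/setP => y; apply/setU1P/imsetP => [[->|/imsetP[u]]|[u]].
  - by exists x; rewrite ?inE.
  - by rewrite inE => uj ->; exists u; rewrite // inE ltnW.
  - rewrite inE ltnS leq_eqVlt => /predU1P[uj|uj] ->.
      by left; congr (s _); apply: val_inj.
    by right; apply: imset_f; rewrite inE.
by apply/map_f/IH; lia.
Qed.

(** An injection suffices: a permutation is determined by the list [codom s] of its seats. *)
Lemma nb_polite_le_completions (n : nat) :
  nb_polite n <= size (completions n (@set0 'I_n)).
Proof.
rewrite /nb_polite cardE -(size_map (fun s : {perm 'I_n} => codom s)).
apply: uniq_leq_size.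
  rewrite map_inj_uniq ?enum_uniq // => s1 s2 /eq_in_map eq_s.
  by apply/permP => x; apply: eq_s; rewrite mem_enum.
move=> _ /mapP[s + ->]; rewrite mem_enum inE => ps.
have -> : set0 = [set s u | u : 'I_n & u < 0].
  by apply/esym/setP => x; rewrite inE; apply/imsetP => -[u]; rewrite inE.
by rewrite -[codom s]drop0 polite_completion ?addn0.
Qed.

Theorem mainTheorem3 (n : nat) (hn : (0 < n)%N) :
  (nb_polite n <= \sum_(1 <= i < n.+1)
     (ceil_div (2 * (i - 1)) 3 + ceil_div (2 * (n - i)) 3)`!
     * (n - ceil_div (2 * (i - 1)) 3 - ceil_div (2 * (n - i)) 3)`!)%N.
Proof.
apply: leq_trans (nb_polite_le_completions n) _.
have -> : completions n (@set0 'I_n) = completions n.-1.+1 set0.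
  by rewrite prednK.
(* The place of the first person becomes the summation index, shifted from 1..n to ordinals. *)
rewrite big_add1 big_mkord size_completionsS /=.
rewrite big_mkcond; apply: leq_sum => i _; case: ifP => // _.
by rewrite setU0 -subnDA subn1 /=; apply: size_completions1.
Qed.
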